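(* Define integers $s_n(i,j)$ ($n\ge0$, $i,j\in\mathbb Z$) by $s_0(1,0)=1$, $s_0(i,j)=0$ for $(i,j)\ne(1,0)$, and $$\begin{aligned}s_{n+1}(i,j)&=i(i+1)s_n(i+1,j-2)+i(2j-1)s_n(i,j-1)+4i(3n+5-i-2j)s_n(i,j-2)+j^2s_n(i-1,j)\\&\quad+\big(4(j-1)(3n+4-i-2j)+6n+6-2i-2j\big)s_n(i-1,j-1)\\&\quad+4(3n+6-i-2j)(3n+5-i-2j)s_n(i-1,j-2).\end{aligned}$$ Then for $n\ge1$, $$S_n(x,y,z)=\sum_{i=1}^{n}z^{i}\sum_{j=1}^{\lfloor(3n+1-i)/2\rfloor}s_{n}(i,j)(xy)^{j}(x+y)^{3n+1-i-2j}.$$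
   Context: $M_n=\{\overline1,1,1,\overline2,2,2,\dots,\overline n,n,n\}$ with the total order $\overline1<1<\overline2<2<\cdots<\overline n<n$. A Jacobi-Stirling permutation of $M_n$ is a permutation $\pi_1\cdots\pi_{3n}$ of $M_n$ such that for each $i\in[n]$ all entries between the two occurrences of the unbarred $i$ are larger than $i$; $\mathrm{JSP}_n$ is the set of these. Set $\pi_0=\pi_{3n+1}=0$; for $0\le i\le 3n$, $i$ is an ascent, descent or plateau if $\pi_i<\pi_{i+1}$, $\pi_i>\pi_{i+1}$ or $\pi_i=\pi_{i+1}$, counted by $\mathrm{asc},\mathrm{des},\mathrm{plat}$. $S_n(x,y,z)=\sum_{\pi\in\mathrm{JSP}_n}x^{\mathrm{asc}(\pi)}y^{\mathrm{des}(\pi)}z^{\mathrm{plat}(\pi)}$. *)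

(* Defs.v *)
From mathcomp Require Import all_boot all_order all_algebra.
From mathcomp Require Export mpoly.

Set Implicit Arguments.
Unset Strict Implicit.
Unset Printing Implicit Defensive.

Import Order.TTheory GRing.Theory Num.Theory.
Import Order.LexiSyntax.
Local Open Scope ring_scope.

(* Lexicographic order with false < true: this is exactly
   bar 1 < 1 < bar 2 < 2 < ... *)
Notation letter := (nat *l bool)%type.

Definition bar (i : nat) : letter := (i, false).
Definition unbar (i : nat) : letter := (i, true).

(* The boundary value pi_0 = pi_{3n+1} = 0.  The letters of index 0 do not
   occur in M_n, and (0, false) is smaller than bar i and unbar i for i >= 1. *)
Definition zero_letter : letter := (0%N, false).

Definition lt_letter (a b : letter) : bool := (a < b)%O.

Definition multiset_M (n : nat) : seq letter :=
  flatten [seq [:: bar i; unbar i; unbar i] | i <- iota 1 n].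

Definition is_jacobi_stirling (n : nat) (p : seq letter) : bool :=
  all (fun i : nat =>
    [forall a : 'I_(size p), forall b : 'I_(size p), forall c : 'I_(size p),
      [&& (a < b)%N, (b < c)%N,
          nth zero_letter p a == unbar i & nth zero_letter p c == unbar i]
      ==> lt_letter (unbar i) (nth zero_letter p b)])
    (iota 1 n).

(* permutations enumerates the distinct rearrangements of a multiset,
   each of them once. *)
Definition JSP (n : nat) : seq (seq letter) :=
  [seq p <- permutations (multiset_M n) | is_jacobi_stirling n p].

Definition entry (p : seq letter) (k : nat) : letter :=
  nth zero_letter (zero_letter :: rcons p zero_letter) k.

Definition asc (p : seq letter) : nat :=
  #|[set k : 'I_(size p).+1 | lt_letter (entry p k) (entry p k.+1)]|.

Definition des (p : seq letter) : nat :=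
  #|[set k : 'I_(size p).+1 | lt_letter (entry p k.+1) (entry p k)]|.

Definition plat (p : seq letter) : nat :=
  #|[set k : 'I_(size p).+1 | entry p k == entry p k.+1]|.

Definition varx : {mpoly int[3]} := 'X_(0 : 'I_3).
Definition vary : {mpoly int[3]} := 'X_(1 : 'I_3).
Definition varz : {mpoly int[3]} := 'X_(2 : 'I_3).

Definition S_poly (n : nat) : {mpoly int[3]} :=
  \sum_(p <- JSP n) varx ^+ asc p * vary ^+ des p * varz ^+ plat p.

Fixpoint s_coef (n : nat) (i j : int) {struct n} : int :=
  match n with
  | 0%N => if (i == 1) && (j == 0) then 1 else 0
  | m.+1 =>
      let N : int := m%:Z in
      i * (i + 1) * s_coef m (i + 1) (j - 2)
      + i * (2 * j - 1) * s_coef m i (j - 1)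
      + 4 * i * (3 * N + 5 - i - 2 * j) * s_coef m i (j - 2)
      + j ^+ 2 * s_coef m (i - 1) j
      + (4 * (j - 1) * (3 * N + 4 - i - 2 * j) + 6 * N + 6 - 2 * i - 2 * j)
          * s_coef m (i - 1) (j - 1)
      + 4 * (3 * N + 6 - i - 2 * j) * (3 * N + 5 - i - 2 * j)
          * s_coef m (i - 1) (j - 2)
  end.

(* Main.v *)
(* Removing the three largest letters from a Jacobi-Stirling permutation of
   M_(n+1) leaves one of M_n; conversely bar (n+1) is inserted in an arbitrary
   slot, and then the block (n+1)(n+1) in an arbitrary slot.  A slot is an
   ascent, a descent or a plateau, i.e. a factor x, y or z of the weight, and
   inserting k+1 equal maximal letters there replaces this factor by x z^k y.
   Hence, with D = d/dx + d/dy + d/dz,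
     S_(n+1) = xyz D (xy D S_n).
   Put u = xy and v = x + y.  Since D u = v, D v = 2 and D z = 1, the algebra
   generated by z, u, v is stable under this operator, and comparing the
   coefficients of z^i u^j v^(3n+1-i-2j) gives the recurrence of s_n(i,j). *)
Require Import Defs.
From mathcomp Require Import all_boot all_order all_algebra.
From mathcomp Require Import ring zify.

Set Implicit Arguments.
Unset Strict Implicit.
Unset Printing Implicit Defensive.

Import Order.TTheory GRing.Theory Num.Theory.
Local Open Scope ring_scope.

Local Notation P3 := {mpoly int[3]}.

(** * The derivation D on polynomials *)

Definition dsum (p : P3) : P3 :=
  p^`M(0 : 'I_3) + p^`M(1 : 'I_3) + p^`M(2 : 'I_3).

Lemma dsumD (p q : P3) : dsum (p + q) = dsum p + dsum q.
Proof. rewrite /dsum !mderivD; ring. Qed.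

Lemma dsum_sum (I : Type) (r : seq I) (F : I -> P3) :
  dsum (\sum_(i <- r) F i) = \sum_(i <- r) dsum (F i).
Proof. by rewrite /dsum !raddf_sum !big_split. Qed.

Lemma dsumM (p q : P3) : dsum (p * q) = dsum p * q + p * dsum q.
Proof. rewrite /dsum !mderivM; ring. Qed.

Lemma dsum_int (a : int) : dsum a%:~R = 0.
Proof. by rewrite /dsum !raddfMz /= !mderivC !mul0rz !addr0. Qed.

Lemma dsumZ (a : int) (p : P3) : dsum (a%:~R * p) = a%:~R * dsum p.
Proof. by rewrite dsumM dsum_int mul0r add0r. Qed.

Lemma dsum_var (i : 'I_3) : dsum 'X_i = 1.
Proof.
rewrite /dsum !mderivX !mnm1E.
case: i => [[|[|[|//]]] h]; rewrite -!val_eqE /= ?scale0r ?addr0 ?add0r scale1r;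
  by rewrite -mpolyX0; congr ('X_[_]); apply/mnmP=> j;
     rewrite mnmBE !mnm1E mnm0E -!val_eqE /= subnn.
Qed.

Lemma dsumX (p : P3) (n : nat) : dsum (p ^+ n) = n%:R * p ^+ n.-1 * dsum p.
Proof.
elim: n => [|[|n] IH]; first by rewrite (dsum_int 1) !mul0r.
  by rewrite expr1 expr0 !mul1r.
rewrite exprS dsumM IH /= exprS -[n.+2]add1n natrD; ring.
Qed.

(** * Weights of words and insertion of a maximal block *)

Definition step_weight (a b : letter) : P3 :=
  varx ^+ lt_letter a b * vary ^+ lt_letter b a * varz ^+ (a == b).

Fixpoint word_weight (a : letter) (p : seq letter) : P3 :=
  if p is b :: p' then step_weight a b * word_weight b p'
  else step_weight a zero_letter.

Lemma step_weight_lt (a b : letter) : lt_letter a b -> step_weight a b = varx.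
Proof.
rewrite /step_weight /lt_letter => ab.
by rewrite ab lt_gtF // lt_eqF // expr1 !expr0 !mulr1.
Qed.

Lemma step_weight_gt (a b : letter) : lt_letter b a -> step_weight a b = vary.
Proof.
rewrite /step_weight /lt_letter => ab.
by rewrite ab lt_gtF // gt_eqF // expr1 !expr0 mul1r !mulr1.
Qed.

Lemma step_weight_eq (a : letter) : step_weight a a = varz.
Proof. by rewrite /step_weight /lt_letter ltxx eqxx !mul1r. Qed.

Lemma dsum_step_weight (a b : letter) : dsum (step_weight a b) = 1.
Proof.
have [ab|ba|->] := ltgtP a b; last by rewrite step_weight_eq dsum_var.
- by rewrite step_weight_lt // dsum_var.
- by rewrite step_weight_gt // dsum_var.
Qed.

(** Each of the three powers is a product over positions, so they merge into one product of step
    weights. *)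
Lemma word_weightE (p : seq letter) :
  varx ^+ asc p * vary ^+ des p * varz ^+ plat p = word_weight zero_letter p.
Proof.
have expE (x : P3) (k : nat) (Q : pred 'I_k) :
    x ^+ #|[set i : 'I_k | Q i]| = \prod_(i < k) x ^+ Q i.
  by rewrite -sum1dep_card big_mkcond prodrXr /=; congr (_ ^+ _);
     apply: eq_bigr => i _; case: (Q i).
rewrite /asc /des /plat !expE -!big_split /= /entry.
suff main a : \prod_(i < (size p).+1)
    step_weight (nth zero_letter (a :: rcons p zero_letter) i)
                (nth zero_letter (rcons p zero_letter) i) = word_weight a p.
  exact: main.
elim: p a => [|b p IH] a /=; first by rewrite big_ord_recl big_ord0 mulr1.
by rewrite big_ord_recl /= -IH.
Qed.

(* The block has [k.+1] letters, so that it is never empty. *)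
Definition insert_block (c : letter) (k : nat) (p : seq letter) (a : nat) :
    seq letter :=
  take a p ++ nseq k.+1 c ++ drop a p.

(** Every step weight is a variable, of derivative 1, so the Leibniz rule deletes one step factor at
    a time, just as cutting the word at each slot does. *)
Lemma sum_word_weight_insert_block (c : letter) (k : nat) (p : seq letter) :
  lt_letter zero_letter c -> all (lt_letter^~ c) p ->
  \sum_(a <- iota 0 (size p).+1) word_weight zero_letter (insert_block c k p a)
  = varx * vary * varz ^+ k * dsum (word_weight zero_letter p).
Proof.
move=> c0; have nseqE q : word_weight c (nseq k c ++ q) =
    varz ^+ k * word_weight c q.
  by elim: k => [|k IH] /=; rewrite ?mul1r // IH step_weight_eq exprS mulrA.
suff main a : lt_letter a c -> all (lt_letter^~ c) p ->
  \sum_(i <- iota 0 (size p).+1) word_weight a (insert_block c k p i)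
  = varx * vary * varz ^+ k * dsum (word_weight a p) by exact: main.
elim: p a => [|b p IH] a ac /=.
  rewrite big_seq1 /insert_block /= nseqE /= !dsum_step_weight step_weight_lt //.
  by rewrite step_weight_gt // => _; ring.
case/andP=> bc pc.
(* Slot [0] breaks the step from [a] to [b], every later slot keeps it: these are the two Leibniz
   terms. *)
rewrite -[0%N :: _]/(0%N :: iota (1 + 0) (size p).+1) big_cons iotaDl big_map.
under eq_bigr do rewrite add1n /insert_block /=.
rewrite -mulr_sumr [X in _ + _ * X]IH // dsumM dsum_step_weight.
rewrite /insert_block /= nseqE /= step_weight_lt // step_weight_gt //; ring.
Qed.

(** * The multiset and the Jacobi-Stirling condition *)

Lemma lt_letter_index (a b : letter) : (a.1 < b.1)%N -> lt_letter a b.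
Proof. by move=> ab; rewrite /lt_letter ltEprodlexi !leEnat ltnW // leqNgt ab. Qed.

Lemma multiset_MS (n : nat) :
  multiset_M n.+1 = multiset_M n ++ [:: bar n.+1; unbar n.+1; unbar n.+1].
Proof.
by rewrite /multiset_M -(addn1 n) iotaD map_cat flatten_cat /= add1n addn1.
Qed.

Lemma multiset_M_index (n : nat) (x : letter) :
  x \in multiset_M n -> (0 < x.1 <= n)%N.
Proof.
case/flattenP=> s /mapP[i]; rewrite mem_iota add1n ltnS => hi ->.
by rewrite !inE => /or3P[] /eqP->.
Qed.

Lemma subseq_consP (T : eqType) (x : T) (s q : seq T) :
  subseq (x :: s) q -> exists q1 q2, q = q1 ++ x :: q2 /\ subseq s q2.
Proof.
elim: q => [//|y q IH] /=; case: eqP => [<-|_] h; first by exists [::], q.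
by have [q1 [q2 [-> h2]]] := IH h; exists (y :: q1), q2.
Qed.

(* Stated with [subseq], the condition is visibly stable under deletions. *)
Lemma is_jacobi_stirlingP (n : nat) (p : seq letter) :
  reflect (forall i, (0 < i <= n)%N -> forall x,
             subseq [:: unbar i; x; unbar i] p -> lt_letter (unbar i) x)
          (is_jacobi_stirling n p).
Proof.
apply: (iffP allP) => H i.
  move=> hi x /subseq_consP[p1 [q [pE /subseq_consP[p2 [r [qE]]]]]].
  case/subseq_consP=> p3 [t [rE _]]; rewrite qE rE in pE.
  have i_n: i \in iota 1 n by rewrite mem_iota add1n ltnS.
  have := H i i_n; rewrite pE.
  move/forallP; set w := p1 ++ _.
  have ha : (size p1 < size w)%N by rewrite /w !size_cat /=; lia.
  have hb : (size p1 + (size p2).+1 < size w)%N.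
    by rewrite /w !size_cat /= !size_cat /=; lia.
  have hc : (size p1 + (size p2 + (size p3).+1).+1 < size w)%N.
    by rewrite /w !size_cat /= !size_cat /= size_cat /=; lia.
  move/(_ (Ordinal ha))/forallP/(_ (Ordinal hb))/forallP/(_ (Ordinal hc)) => /=.
  have -> : nth zero_letter w (size p1) = unbar i.
    by rewrite /w nth_cat ltnn subnn.
  have -> : nth zero_letter w (size p1 + (size p2).+1) = x.
    by rewrite /w nth_cat ltnNge leq_addr /= addKn /= nth_cat ltnn subnn.
  have -> : nth zero_letter w (size p1 + (size p2 + (size p3).+1).+1) = unbar i.
    rewrite /w nth_cat ltnNge leq_addr /= addKn /= nth_cat ltnNge leq_addr /=.
    by rewrite addKn /= nth_cat ltnn subnn.
  move/implyP; apply; rewrite !eqxx; lia.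
rewrite mem_iota add1n ltnS => hi.
apply/forallP=> a; apply/forallP=> b; apply/forallP=> c; apply/implyP.
case/and3P=> ab bc /andP[/eqP pa /eqP pc]; apply: (H i hi).
(* Cutting just before position [b] leaves one [unbar i] to find on each side of it. *)
rewrite -[X in subseq _ X](cat_take_drop b p) (drop_nth zero_letter (ltn_ord b)).
apply: (@cat_subseq _ [:: _] [:: _; _]).
  by rewrite sub1seq -[X in X \in _]pa -(nth_take zero_letter ab) mem_nth //
    size_take_min leq_min ab /=.
rewrite /= eqxx sub1seq -[X in X \in _]pc -[X in nth _ _ X](subnKC bc).
rewrite -nth_drop mem_nth // size_drop.
by rewrite ltn_sub2r // (leq_ltn_trans bc).
Qed.

(** * Generation of [JSP n.+1] by insertion into [JSP n] *)

Lemma unbar_eq_bar (n : nat) : (unbar n == bar n) = false.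
Proof. by rewrite xpair_eqE andbF. Qed.

Lemma perm_insert_block (c : letter) (k : nat) (p : seq letter) (a : nat) :
  perm_eq (insert_block c k p a) (nseq k.+1 c ++ p).
Proof. by rewrite /insert_block perm_catCA perm_cat2l cat_take_drop. Qed.

Lemma filter_insert_block (c : letter) (k : nat) (p : seq letter) (a : nat) :
  c \notin p -> filter (predC1 c) (insert_block c k p a) = p.
Proof.
move=> cp; rewrite /insert_block !filter_cat filter_nseq /= eqxx mul0n cat0s -filter_cat.
rewrite cat_take_drop; apply/all_filterP/allP=> x xp /=.
by apply: contraNneq cp => <-.
Qed.

Lemma index_insert_block (c : letter) (k : nat) (p : seq letter) (a : nat) :
  c \notin p -> (a <= size p)%N -> index c (insert_block c k p a) = a.
Proof.
move=> cp ap; rewrite /insert_block index_cat /= eqxx addn0.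
by rewrite (negbTE (contra (@mem_take a _ p c) cp)) size_take_min (minn_idPl ap).
Qed.

Definition insert_all (c : letter) (k : nat) (s : seq (seq letter)) :=
  [seq insert_block c k p a | p <- s, a <- iota 0 (size p).+1].

Lemma mem_slot (a m : nat) : (a <= m)%N -> a \in iota 0 m.+1.
Proof. by rewrite mem_iota. Qed.

(** Insertion is injective: deleting [c] recovers the word, and the first position of [c] recovers
    the slot. *)
Lemma insert_all_uniq (c : letter) (k : nat) (s : seq (seq letter)) :
  uniq s -> {in s, forall p, c \notin p} -> uniq (insert_all c k s).
Proof.
move=> us cs; apply: allpairs_uniq_dep => // [p _|]; first exact: iota_uniq.
move=> _ _ /allpairsPdep[p [a [ps ia ->]]] /allpairsPdep[q [b [qs ib ->]]] /=.
rewrite !mem_iota !add0n !ltnS /= in ia ib => pq.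
have epq : p = q.
  by rewrite -(filter_insert_block k a (cs p ps)) pq filter_insert_block // cs.
rewrite -epq in pq ib *; congr (existT _ _ _).
by rewrite -(index_insert_block k (cs p ps) ia) pq index_insert_block // cs.
Qed.

Lemma mem_JSP (n : nat) (p : seq letter) :
  (p \in JSP n) = is_jacobi_stirling n p && perm_eq p (multiset_M n).
Proof. by rewrite mem_filter mem_permutations. Qed.

Lemma notin_JSP (n : nat) (b : bool) (p : seq letter) :
  p \in JSP n -> (n.+1, b) \notin p.
Proof.
rewrite mem_JSP => /andP[_ /perm_mem pM]; rewrite pM.
by apply/negP => /multiset_M_index /=; rewrite ltnn.
Qed.

Lemma subseq_skip (T : eqType) (c : T) (s p q : seq T) :
  c \notin p -> subseq (c :: s) (p ++ q) -> subseq (c :: s) q.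
Proof.
elim: p => [//|x p IH]; rewrite inE negb_or => /andP[/negbTE cx cp] /=.
by rewrite cx => /(IH cp).
Qed.

(** The two copies of [c] are adjacent, and there is no third copy to serve as [x]. *)
Lemma subseq_insert_block1 (c x : letter) (p : seq letter) (a : nat) :
  c \notin p -> ~~ subseq [:: c; x; c] (insert_block c 1 p a).
Proof.
move=> cp; apply/negP; move/subseq_skip => /(_ (contra (@mem_take a _ p c) cp)).
have cd : c \notin drop a p := contra (@mem_drop a _ p c) cp.
rewrite /= eqxx; case: eqP => _; first by rewrite sub1seq (negbTE cd).
by move/mem_subseq/(_ c); rewrite !inE eqxx orbT (negbTE cd) => /(_ isT).
Qed.

Lemma mem_JSPS (n : nat) (q : seq letter) :
  (q \in JSP n.+1) =
  (q \in insert_all (unbar n.+1) 1 (insert_all (bar n.+1) 0 (JSP n))).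
Proof.
apply/idP/allpairsPdep; last first.
  case=> r [a' [/allpairsPdep[p [a [pJ _ ->]]] _ ->]].
  have bp := notin_JSP false pJ; have up := notin_JSP true pJ.
  have ur : unbar n.+1 \notin insert_block (bar n.+1) 0 p a.
    by rewrite (perm_mem (perm_insert_block _ _ _ _)) inE unbar_eq_bar.
  move: pJ; rewrite !mem_JSP => /andP[/is_jacobi_stirlingP pJ pM].
  apply/andP; split; last first.
    apply: perm_trans (perm_insert_block _ _ _ _) _; rewrite perm_catC multiset_MS.
    rewrite perm_sym -(cat1s (bar _)) catA perm_cat2r perm_sym.
    by apply: perm_trans (perm_insert_block _ _ _ _) _; rewrite perm_catC perm_cat2r.
  apply/is_jacobi_stirlingP=> i /andP[i0]; rewrite leq_eqVlt => /orP[/eqP->|hi] x.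
    by rewrite (negbTE (subseq_insert_block1 _ _ ur)).
  move=> h; have [xn|xn] := eqVneq x.1 n.+1.
    by apply: lt_letter_index; rewrite /= xn.
  apply: (pJ i); first by rewrite i0.
  (* Neither [x] nor [unbar i] is a new letter here, so the pattern survives deleting the new
     ones. *)
  rewrite -(filter_insert_block 0 a bp) -(filter_insert_block 1 a' ur) !subseq_filter h /= /bar /unbar.
  by case: x xn h => x1 x2 /= xn _; rewrite !xpair_eqE (negbTE xn) ltn_eqF.
rewrite mem_JSP => /andP[/is_jacobi_stirlingP qJ qM].
have uq : unbar n.+1 \in q.
  by rewrite (perm_mem qM) multiset_MS mem_cat !inE eqxx !orbT.
move: qJ qM; case/splitPr: uq => s1 s qJ qM.
have ss1 : perm_eq (s ++ s1) (multiset_M n ++ [:: bar n.+1; unbar n.+1]).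
  rewrite -(perm_cons (unbar n.+1)) -cat_cons perm_catC.
  apply: perm_trans qM _; rewrite multiset_MS -(cat1s (unbar _) (_ ++ _)).
  by rewrite perm_sym perm_catCA perm_cat2l (perm_catC [:: _]).
have us : unbar n.+1 \in s ++ s1.
  by rewrite (perm_mem ss1) mem_cat !inE eqxx !orbT.
(* If the other copy of [unbar n.+1] lies in [s1], the word is cut there instead. *)
wlog us2 : s1 s {ss1} us qJ qM / unbar n.+1 \in s.
  move=> H; move: (us); rewrite mem_cat => /orP[/H|us1]; first exact.
  move: us qJ qM; case/splitPr: us1 => t1 t2 us qJ qM; rewrite -catA /=; apply: H.
  - by rewrite mem_cat mem_cat inE eqxx !orbT.
  - by rewrite -catA in qJ.
  - by rewrite -catA in qM.
  - by rewrite mem_cat inE eqxx orbT.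
move: us qJ qM; case/splitPr: us2 => s2 s3 us qJ qM.
(* A letter between the two copies would have to exceed [unbar n.+1], the largest letter of the
   multiset. *)
have {}us : s2 = [::].
  move: us qJ qM; case: s2 => // x s2 us qJ qM; have := qJ n.+1.
  rewrite ltnS leqnn => /(_ isT x) h.
  have {}h : lt_letter (unbar n.+1) x.
    apply: h; apply: subseq_trans (suffix_subseq s1 _) => /=; rewrite !eqxx.
    by rewrite sub1seq mem_cat inE eqxx orbT.
  have := (@multiset_M_index n.+1 x).
  rewrite -(perm_mem qM) mem_cat !inE eqxx !orbT => /(_ isT) /andP[_ xn].
  move: h; rewrite /lt_letter ltEprodlexi !leEnat /=.
  by case: {+}x xn => x1 [] /= xn; rewrite ?ltxx; lia.
rewrite {}us /= {s2} in qJ qM *.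
have sM : perm_eq (s1 ++ s3) (multiset_M n ++ [:: bar n.+1]).
  rewrite -(perm_cat2l [:: unbar n.+1; unbar n.+1]) perm_catCA.
  apply: perm_trans qM _; rewrite multiset_MS perm_sym perm_catC -catA.
  by rewrite perm_cat2l.
have bs : bar n.+1 \in s1 ++ s3.
  by rewrite (perm_mem sM) mem_cat inE eqxx orbT.
exists (s1 ++ s3), (size s1); split;
  [| by apply: mem_slot; rewrite size_cat leq_addr
   | by rewrite /insert_block take_size_cat // drop_size_cat].
have {}qJ : forall i, (0 < i <= n.+1)%N -> forall x,
    subseq [:: unbar i; x; unbar i] (s1 ++ s3) -> lt_letter (unbar i) x.
  move=> i hi x h; apply: (qJ i hi); apply: subseq_trans h _.
  by rewrite cat_subseq //; apply: (suffix_subseq [:: _; _]).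
move: (s1 ++ s3) sM bs qJ => r sM bs; move: sM; case/splitPr: bs => r1 r2 sM qJ.
apply/allpairsPdep; exists (r1 ++ r2), (size r1); split;
  [| by apply: mem_slot; rewrite size_cat leq_addr
   | by rewrite /insert_block take_size_cat // drop_size_cat].
rewrite mem_JSP; apply/andP; split; last first.
  rewrite -(perm_cat2l [:: bar n.+1]) perm_catCA.
  by apply: perm_trans sM _; rewrite perm_catC.
apply/is_jacobi_stirlingP=> i /andP[i0 ni] x h.
apply: (qJ i); first by rewrite i0 leqW.
by apply: subseq_trans h _; rewrite cat_subseq // subseq_cons.
Qed.

Lemma perm_JSPS (n : nat) :
  perm_eq (JSP n.+1)
          (insert_all (unbar n.+1) 1 (insert_all (bar n.+1) 0 (JSP n))).
Proof.
apply: uniq_perm; last exact: mem_JSPS.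
  exact/filter_uniq/permutations_uniq.
apply: insert_all_uniq; first apply: insert_all_uniq.
- exact/filter_uniq/permutations_uniq.
- by move=> p; apply: notin_JSP.
- move=> _ /allpairsPdep[p [a [/(notin_JSP true) up _ ->]]].
  by rewrite (perm_mem (perm_insert_block _ _ _ _)) inE unbar_eq_bar.
Qed.

(** * The differential recurrence for [S_poly] *)

Lemma sum_insert_all (c : letter) (k : nat) (s : seq (seq letter)) :
  lt_letter zero_letter c -> {in s, forall p, all (lt_letter^~ c) p} ->
  \sum_(p <- insert_all c k s) word_weight zero_letter p =
  varx * vary * varz ^+ k *
    dsum (\sum_(p <- s) word_weight zero_letter p).
Proof.
move=> c0 sc; rewrite big_allpairs_dep dsum_sum mulr_sumr.
apply: eq_big_seq => p ps; exact: sum_word_weight_insert_block (sc p ps).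
Qed.

Lemma S_polyE (n : nat) :
  S_poly n = \sum_(p <- JSP n) word_weight zero_letter p.
Proof. by apply: eq_bigr => p _; rewrite word_weightE. Qed.

Lemma S_polyS (n : nat) :
  S_poly n.+1 =
  varx * vary * varz * dsum (varx * vary * dsum (S_poly n)).
Proof.
rewrite !S_polyE (perm_big _ (perm_JSPS n)) /=.
have JSP_lt b p : p \in JSP n -> all (lt_letter^~ (n.+1, b)) p.
  rewrite mem_JSP => /andP[_ pM]; apply/allP=> x; rewrite (perm_mem pM).
  by case/multiset_M_index/andP => _ xn; apply: lt_letter_index.
(* In the outer insertion the words already contain [bar n.+1], which is still below
   [unbar n.+1]. *)
rewrite sum_insert_all ?expr1 //; last first.
  move=> _ /allpairsPdep[p [a [/(JSP_lt true) pn _ ->]]].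
  by rewrite (perm_all _ (perm_insert_block _ _ _ _)) /= pn /lt_letter
    ltEprodlexi !leEnat /= leqnn.
by rewrite sum_insert_all ?expr0 ?mulr1 // => p; apply: JSP_lt.
Qed.

Lemma S_poly0 : S_poly 0 = varz.
Proof.
rewrite S_polyE; have -> : JSP 0 = [:: [::]] by [].
by rewrite big_seq1 /= step_weight_eq.
Qed.

(** * The operator on monomials in [varz], [u] and [v] *)

Local Notation u := (varx * vary).
Local Notation v := (varx + vary).

Lemma dsum_u : dsum u = v.
Proof. by rewrite dsumM !dsum_var mul1r mulr1 addrC. Qed.

Lemma dsum_v : dsum v = 2%:R.
Proof. by rewrite dsumD !dsum_var. Qed.

Definition monom (a b c : nat) : P3 := varz ^+ a * (u ^+ b * v ^+ c).

(** The six terms match those of the recurrence. Where [c.-1] or [c.-2] is truncated, its numerical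
    coefficient is zero. *)
Lemma step_monom (a b c : nat) :
  u * varz * dsum (u * dsum (monom a.+1 b c)) =
    (a * a.+1)%:R * monom a b.+2 c
  + (a.+1 * (2 * b + 1))%:R * monom a.+1 b.+1 c.+1
  + (4 * a.+1 * c)%:R * monom a.+1 b.+2 c.-1
  + (b ^ 2)%:R * monom a.+2 b c.+2
  + (4 * b * c + 2 * c + 2 * b)%:R * monom a.+2 b.+1 c
  + (4 * c * c.-1)%:R * monom a.+2 b.+2 c.-2.
Proof.
have [Du Dv Dz] := And3 dsum_u dsum_v (dsum_var 2 : dsum varz = 1).
(* Only the derivatives of [varz], [u] and [v] matter below, so the polynomials become opaque. *)
rewrite /monom; move: (varz) u v Du Dv Dz => z p q Dp Dq Dz.
have Dn k : dsum k%:R = 0 by exact: (dsum_int k).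
have [DM DD DX] := And3 dsumM dsumD dsumX.
move: dsum DM DD DX Dp Dq Dz Dn => D DM DD DX Dp Dq Dz Dn.
have Ez k : z * D (z ^+ k) = k%:R * z ^+ k.
  by rewrite DX Dz; case: k => [|k] /=; rewrite ?exprS; ring.
have Ep k : p * D (p ^+ k) = k%:R * (p ^+ k * q).
  by rewrite DX Dp; case: k => [|k] /=; rewrite ?exprS; ring.
have Z1 : z * D (z ^+ a.+1) = a.+1%:R * z ^+ a.+1 := Ez a.+1.
have Z2 : z * D (D (z ^+ a.+1)) = (a * a.+1)%:R * z ^+ a.
  rewrite DX Dz mulr1 DM Dn mul0r add0r mulrCA Ez; ring.
(* Differentiating [Ep b] gives this without treating the exponents [b - 1] and [b - 2]
   separately. *)
have P2 : p * (p * D (D (p ^+ b))) =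
    (b%:R * (b%:R - 1) * q ^+ 2 + 2%:R * b%:R * p) * p ^+ b.
  have := congr1 D (Ep b); rewrite !DM Dn Dp Dq.
  move: (Ep b); move: (D (p ^+ b)) => P1 EP1.
  move: (D P1) (p ^+ b) EP1 => P2 P0 EP1 EP2.
  have -> : p * P2 = b%:R * (P1 * q + P0 * 2%:R) - q * P1.
    by apply/eqP; rewrite eq_sym subr_eq [_ + q * P1]addrC EP2 mul0r add0r.
  transitivity ((b%:R - 1) * q * (p * P1) + 2%:R * b%:R * p * P0); first by ring.
  by rewrite EP1; ring.
have V1 : D (q ^+ c) = (2 * c)%:R * q ^+ c.-1.
  by rewrite DX Dq; ring.
have qV1 : q * D (q ^+ c) = (2 * c)%:R * q ^+ c.
  by rewrite V1; case: (c) => [|k] /=; rewrite ?exprS; ring.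
have V2 : D (D (q ^+ c)) = (4 * c * c.-1)%:R * q ^+ c.-2.
  by rewrite V1 DM Dn DX Dq; ring.
move: Z1 Z2 (Ep b) P2 V1 V2 qV1; rewrite !(DM, DD, Dp, Dq, Dz).
move: (D (z ^+ a.+1)) (D (D (z ^+ a.+1))) => Z1 Z2 EZ1 EZ2.
move: (D (p ^+ b)) (D (D (p ^+ b))) => P1 P2 EP1 EP2.
move: (D (q ^+ c)) (D (D (q ^+ c))) => V1 V2 EV1 EV2 EqV1.
rewrite !exprS in EZ1 *.
(* The Leibniz expansion, grouped to fit the closed forms above. *)
transitivity (
    q * p * (z * Z1) * (p ^+ b * q ^+ c) + q * z * z ^+ a * z * (p * P1) * q ^+ c
  + p * z * z * z ^+ a * p ^+ b * (q * V1) + p * p * (z * Z2) * p ^+ b * q ^+ c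
  + z * z * z ^+ a * (p * (p * P2)) * q ^+ c + p * p * z * z * z ^+ a * p ^+ b * V2
  + 2%:R * p * (z * Z1) * (p * P1) * q ^+ c
  + 2%:R * p * p * (z * Z1) * p ^+ b * V1
  + 2%:R * z * z * z ^+ a * (p * P1) * p * V1).
  by ring.
rewrite EZ1 EZ2 EP1 EP2 EqV1 EV2.
(* The multiplier [q] for this [V1] comes from the closed form of [p * P1]. *)
have -> : 2%:R * z * z * z ^+ a * (b%:R * (p ^+ b * q)) * p * V1 =
  2%:R * z * z * z ^+ a * b%:R * p ^+ b * p * (q * V1) by ring.
rewrite EqV1 EV1.
move: (p ^+ b) (z ^+ a) (q ^+ c) (q ^+ c.-1) (q ^+ c.-2) => xb xa x0 x1 x2.
rewrite -mulnn.
ring.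
Qed.

(** * Support of the coefficients *)

(** For positive [n] this is the range of the double sum; [n = 0] is separate because its only index
    [(1, 0)] has [j = 0]. *)
Definition s_support (n : nat) (i j : int) : bool :=
  if n is 0 then (i == 1) && (j == 0)
  else [&& 1 <= i, i <= n%:Z, 1 <= j & i + 2 * j <= 3 * n%:Z + 1].

(** In each term of the recurrence either the source index is outside the support or the factor
    vanishes, as [j ^+ 2] does at [j = 0]. *)
Lemma s_coef_support (n : nat) (i j : int) :
  ~~ s_support n i j -> s_coef n i j = 0.
Proof.
elim: n i j => [|n IH] i j nij; first by rewrite /=; case: ifP nij => //= ->.
have coef0 (c : int) i' j' : (s_support n i' j' -> c = 0) ->
    c * s_coef n i' j' = 0.
  by case: (boolP (s_support n i' j')) => [_ ->|/IH ->] //; rewrite ?mul0r ?mulr0.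
rewrite /= !coef0 ?addr0 //; case: n nij {IH coef0} => [|n] /= nij h.
all: first [lia | nia].
Qed.

(** * Translation and trimming of finite sums *)

Lemma sum_shift (F : int -> P3) (a : int) (B : nat) :
  (forall k, F k != 0 -> (0 <= k < B%:Z) && (0 <= k + a < B%:Z)) ->
  \sum_(0 <= k < B) F (k%:Z - a) = \sum_(0 <= k < B) F k%:Z.
Proof.
(* A negative shift undoes a positive shift of the translated function. *)
wlog [d ->] : F a / exists d : nat, a = d%:Z.
  move=> H FB; case: (intP a) FB => [|d|d] FB.
  - by apply: H FB; exists 0%N.
  - by apply: H FB; exists d.+1.
  under eq_bigr do rewrite opprK.
  rewrite -[LHS](H (fun k => F (k + d.+1%:Z)) d.+1%:Z).
  - by apply: eq_bigr => k _; rewrite subrK.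
  - by exists d.+1.
  - by move=> k /FB; rewrite addrK; lia.
move=> FB; have F0 k : ~~ ((0 <= k) && (k + d%:Z < B%:Z)) -> F k = 0.
  by apply: contraNeq => /FB /andP[/andP[-> _] /andP[_ ->]].
have [dB|Bd] := leqP d B; last first.
  by rewrite !big_nat !big1 // => k /andP[_ kB]; rewrite F0 //; lia.
rewrite (big_cat_nat (leq0n d) dB) (big_cat_nat (leq0n (B - d)) (leq_subr d B)) /=.
rewrite [X in X + _ = _]big_nat [X in X + _ = _]big1 ?add0r => [|k kd];
  last by rewrite F0 //; lia.
rewrite [X in _ = _ + X]big_nat [X in _ = _ + X]big1 ?addr0 => [|k kd];
  last by rewrite F0 //; lia.
rewrite -{1}[d]add0n big_addn; apply: eq_bigr => k _.
by rewrite PoszD addrK.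
Qed.

Lemma sum_shift2 (F : int -> int -> P3) (a b : int) (B : nat) :
  (forall i j, F i j != 0 ->
    [&& 0 <= i < B%:Z, 0 <= i + a < B%:Z, 0 <= j < B%:Z & 0 <= j + b < B%:Z]) ->
  \sum_(0 <= i < B) \sum_(0 <= j < B) F (i%:Z - a) (j%:Z - b) =
  \sum_(0 <= i < B) \sum_(0 <= j < B) F i%:Z j%:Z.
Proof.
move=> FB.
rewrite -[RHS](sum_shift (F := fun i => \sum_(0 <= j < B) F i j%:Z) (a := a)).
  apply: eq_bigr => i _.
  rewrite -[RHS](sum_shift (F := F (i%:Z - a)) (a := b)) // => j.
  by case/FB/and4P => _ _ -> ->.
move=> i; apply: contraNT => hi; rewrite big1 // => j _.
by apply/eqP; apply: contraNT hi => /FB /and4P[-> -> _ _].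
Qed.

Lemma sum_trim (F : nat -> P3) (a b B : nat) :
  (a <= b)%N -> (b <= B)%N ->
  (forall k, ~~ (a <= k < b)%N -> F k = 0) ->
  \sum_(0 <= k < B) F k = \sum_(a <= k < b) F k.
Proof.
move=> ab bB F0.
rewrite (big_cat_nat (leq0n b) bB) (big_cat_nat (leq0n a) ab) /=.
rewrite [X in X + _ + _]big_nat [X in X + _ + _]big1 ?add0r => [|k ka];
  last by rewrite F0 //; lia.
rewrite [X in _ + X]big_nat [X in _ + X]big1 ?addr0 // => k kb; rewrite F0 //; lia.
Qed.

(** * The coefficient recurrence as the action of the operator *)

(** Here [(i, j)] is the source, while the monomial belongs to the target at level [n.+1], whence
    [3 * n + 4]. For the entries of [rec_terms], a negative argument of [absz] always meets a zero
    coefficient. *)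
Definition shifted_term (n : nat) (a b : int) (c : int -> int -> int)
    (i j : int) : P3 :=
  (c i j * s_coef n i j)%:~R
  * monom (absz (i + a)%R) (absz (j + b)%R)
          (absz (3 * n%:Z + 4 - (i + a) - 2 * (j + b))%R).

Definition s_term (n : nat) (i j : int) : P3 :=
  (s_coef n i j)%:~R * monom (absz i) (absz j) (absz (3 * n%:Z + 1 - i - 2 * j)%R).

(* A triple [(a, b, c)] says that [s_coef n i j] contributes with coefficient
   [c i j] to [s_coef n.+1 (i + a) (j + b)]: the recurrence is reindexed by its
   source; [k i j] is the exponent of [v] there. *)
Definition rec_terms (n : nat) : seq (int * int * (int -> int -> int)) :=
  let k i j := 3 * n%:Z + 1 - i - 2 * j in
  [:: (- 1, 2, fun i _ => (i - 1) * i);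
      (0, 1, fun i j => i * (2 * j + 1));
      (0, 2, fun i j => 4 * i * k i j);
      (1, 0, fun _ j => j ^+ 2);
      (1, 1, fun i j => 4 * j * k i j + 2 * k i j + 2 * j);
      (1, 2, fun i j => 4 * k i j * (k i j - 1))].

Lemma termS (n : nat) (i j : int) :
  s_term n.+1 i j =
  \sum_(t <- rec_terms n)
    shifted_term n t.1.1 t.1.2 t.2 (i - t.1.1) (j - t.1.2).
Proof.
rewrite !big_cons big_nil /shifted_term /= !subrK opprK !subr0 !addr0.
have -> : 3 * n%:Z + 4 - i - 2 * j = 3 * n.+1%:Z + 1 - i - 2 * j by lia.
rewrite -!mulrDl -!intrD /s_term /=; congr (_%:~R * _); rewrite !addrA.
by congr (_ + _ + _ + _ + _ + _); congr (_ * _); ring.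
Qed.

Lemma sum_shifted_term (n : nat) (i j : int) :
  \sum_(t <- rec_terms n) shifted_term n t.1.1 t.1.2 t.2 i j =
  varx * vary * varz * dsum (varx * vary * dsum (s_term n i j)).
Proof.
have [nij|/s_coef_support s0] := boolP (s_support n i j); last first.
  rewrite /s_term s0 !big_cons big_nil /shifted_term s0 !mulr0 !mul0r !addr0.
  by rewrite !(dsum_int 0, mulr0).
(* On the support the three exponents are natural numbers, and that of [varz] is positive. *)
have [a ia] : exists a : nat, i = a.+1%:Z.
  by exists (absz (i - 1)%R); case: n nij => [|n] /=; lia.
have [b jb] : exists b : nat, j = b%:Z.
  by exists (absz j); case: n nij => [|n] /=; lia.
have [c kc] : exists c : nat, 3 * n%:Z + 1 - i - 2 * j = c%:Z.
  by exists (absz (3 * n%:Z + 1 - i - 2 * j)%R); case: n nij => [|n] /=; lia.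
have -> : s_term n i j = (s_coef n i j)%:~R * monom a.+1 b c.
  by rewrite /s_term kc ia jb.
have -> : varx * vary * varz *
    dsum (varx * vary * dsum ((s_coef n i j)%:~R * monom a.+1 b c)) =
    (s_coef n i j)%:~R *
    (varx * vary * varz * dsum (varx * vary * dsum (monom a.+1 b c))).
  by rewrite dsumZ mulrCA dsumZ mulrCA.
(* The alternative [N = 0] covers the truncated exponents [c.-1] and [c.-2]. *)
have E (t1 t2 : int) f (N A B C : nat) :
    f i j = N%:Z -> i + t1 = A%:Z -> j + t2 = B%:Z ->
    (N = 0%N \/ 3 * n%:Z + 4 - (i + t1) - 2 * (j + t2) = C%:Z) ->
    shifted_term n t1 t2 f i j = (s_coef n i j)%:~R * (N%:R * monom A B C).
  rewrite /shifted_term => -> -> -> [->|-> /=]; first by rewrite !mul0r mulr0.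
  by rewrite intrM -mulrA mulrCA.
rewrite step_monom !mulrDr /rec_terms !big_cons big_nil addr0 /= !addrA.
have pc : c%:Z * (c%:Z - 1) = (c * c.-1)%N by case: (c) => [|k] /=; lia.
have c1 : (4 * a.+1 * c)%N = 0%N \/ c%:Z - 1 = c.-1.
  by case: (c) => [|k]; [left | right]; lia.
have c2 : (4 * c * c.-1)%N = 0%N \/ c%:Z - 2 = c.-2.
  by case: (c) => [|[|k]]; [left | left | right]; lia.
rewrite (E _ _ _ (a * a.+1)%N a b.+2 c); try by rewrite ?kc ?ia ?jb; lia.
rewrite (E _ _ _ (a.+1 * (2 * b + 1))%N a.+1 b.+1 c.+1);
  try by rewrite ?kc ?ia ?jb; lia.
rewrite (E _ _ _ (4 * a.+1 * c)%N a.+1 b.+2 c.-1); try by rewrite ?kc ?ia ?jb; lia.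
rewrite (E _ _ _ (b ^ 2)%N a.+2 b c.+2); try by rewrite ?kc ?ia ?jb; lia.
rewrite (E _ _ _ (4 * b * c + 2 * c + 2 * b)%N a.+2 b.+1 c);
  try by rewrite ?kc ?ia ?jb; lia.
rewrite (E _ _ _ (4 * c * c.-1)%N a.+2 b.+2 c.-2); try by rewrite ?kc ?ia ?jb; lia.
by [].
Qed.

(** The box stays fixed during the induction; it contains sources and targets alike, so the six
    translations create no boundary terms. *)
Lemma S_poly_box (n B : nat) : (3 * n + 3 <= B)%N ->
  S_poly n = \sum_(0 <= i < B) \sum_(0 <= j < B) s_term n i%:Z j%:Z.
Proof.
elim: n => [|n IH] nB.
  rewrite S_poly0 (sum_trim (a := 1) (b := 2)); try lia.
    rewrite big_nat1 (sum_trim (a := 0) (b := 1)); try lia.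
      by rewrite big_nat1 /s_term /monom /= !mulr1 mul1r.
    by move=> k k0; rewrite /s_term s_coef_support ?mul0r //=; lia.
  move=> k k1; rewrite big1 // => j _.
  by rewrite /s_term s_coef_support ?mul0r //=; lia.
rewrite S_polyS (IH _); last by lia.
rewrite dsum_sum mulr_sumr dsum_sum mulr_sumr.
under eq_bigr do rewrite dsum_sum mulr_sumr dsum_sum mulr_sumr.
under eq_bigr do under eq_bigr do rewrite -sum_shifted_term.
(* The left side is indexed by sources, the right by targets; with the sum over [rec_terms]
   outermost, they differ by one translation per entry. *)
under [RHS]eq_bigr do under eq_bigr do rewrite termS.
under eq_bigr do rewrite exchange_big /=.
under [RHS]eq_bigr do rewrite exchange_big /=.
rewrite exchange_big [RHS]exchange_big /=.
have shift (a b : int) c : (-1 <= a <= 1) && (0 <= b <= 2) ->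
    \sum_(0 <= i < B) \sum_(0 <= j < B)
      shifted_term n a b c (i%:Z - a) (j%:Z - b) =
    \sum_(0 <= i < B) \sum_(0 <= j < B) shifted_term n a b c i%:Z j%:Z.
  move=> ab; rewrite (sum_shift2 (F := shifted_term n a b c)) // => i j st0.
  have : s_support n i j.
    apply: contraNT st0 => /s_coef_support s0.
    by rewrite /shifted_term s0 mulr0 mul0r.
  by case: n nB {IH st0} => [|n'] nB /=; lia.
rewrite /rec_terms !big_cons !big_nil.
by congr (_ + (_ + (_ + (_ + (_ + (_ + _)))))); apply/esym/shift.
Qed.

Theorem theorem14 (n : nat) (hn : (1 <= n)%N) :
  S_poly n =
    \sum_(1 <= i < n.+1)
      varz ^+ i *
      \sum_(1 <= j < ((3 * n + 1 - i) %/ 2).+1)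
        s_coef n i%:Z j%:Z *:
          ((varx * vary) ^+ j * (varx + vary) ^+ (3 * n + 1 - i - 2 * j)).
Proof.
have s0 i j : ~~ [&& (1 <= i)%N, (i <= n)%N, (1 <= j)%N &
    (i + 2 * j <= 3 * n + 1)%N] -> s_term n i%:Z j%:Z = 0.
  move=> ij; rewrite /s_term s_coef_support ?mul0r //.
  by case: n hn ij => // m _; rewrite /s_support; lia.
(* Vanishing off the support cuts the square box down to the ranges of the statement. *)
rewrite (S_poly_box (leqnn _)) (sum_trim (a := 1) (b := n.+1)); try lia; last first.
  by move=> i hi; rewrite big1 // => j _; rewrite s0 //; lia.
apply: eq_big_nat => i /andP[i1 ni]; rewrite mulr_sumr.
rewrite (sum_trim (a := 1) (b := ((3 * n + 1 - i) %/ 2).+1)); try lia; last first.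
  by move=> j hj; rewrite s0 //; lia.
apply: eq_big_nat => j /andP[j1 nj].
rewrite /s_term /monom -[s_coef n i j in RHS]intz scaler_int -mulrzr.
have -> : absz (3 * n%:Z + 1 - i%:Z - 2 * j%:Z)%R = (3 * n + 1 - i - 2 * j)%N by lia.
rewrite /=; ring.
Qed.
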